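(* Let $(\mathcal{E},\|\cdot\|)$ be a normed vector space and let $T$ be a $\gamma$-Lipschitz operator. Consider the algorithm AdaGHAL (defined in the context), with parameters $\beta,\beta'\in(0,1)$, applied to $T$ for a target $\epsilon>0$ and initialized at some $x_0$. Then all of the following statements apply, depending on the value of $\gamma$. 1. If $\gamma<1$, then the algorithm outputs $\hat x_k$ such that $\|T(\hat x_k)-\hat x_k\|\le\epsilon$ within the number of oracle queries to $T$ bounded by $$\mathcal{O}\Big(\log_{1/\beta}\Big(\frac1\gamma\Big)+\frac{\ln(\beta(1-\beta))}{\ln(\gamma)}+\frac{\ln(\|T(x_0)-x_0\|/\epsilon)}{\ln(1/\gamma)}\Big(1+\frac{\ln(1-\beta)}{\ln(\beta)}\Big)\Big).$$ 2. If $\gamma=1$ and $x_*$ is a fixed point of $T$, then the algorithm outputs $\hat x_k$ such that $\|T(\hat x_k)-\hat x_k\|\le\epsilon$ within the number of oracle queries to $T$ bounded by $$\mathcal{O}\Big(\frac{\|x_0-x_*\|}{\epsilon}\cdot\frac{-\ln(\beta(1-\beta))}{\beta^4}\Big).$$ 3. If $\gamma>1$, and there is a bounded convex set $\mathcal{C}\subset\mathcal{E}$ with $T:\mathcal{C}\to\mathcal{C}$, $\sup_{x,y\in\mathcal{C}}\|x-y\|\le D<\infty$ and $x_0\in\mathcal{C}$, then the algorithm outputs $\hat x_k$ such that $\|T(\hat x_k)-\hat x_k\|\le\min\{\epsilon_{k-1}/\beta,\,D\}=:\bar\epsilon$, where $$\epsilon_{k-1}<(1+\beta^2)\frac{D_k}{\beta^2}\frac{\gamma-1}{1-\beta'}\le\frac{D(1+\beta^2)}{\beta^3}\frac{\gamma-1}{1-\beta'}.$$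 If the algorithm outputs $\hat x_k$ with the fixed-point residual $\|T(\hat x_k)-\hat x_k\|=\hat\epsilon\in(\beta\epsilon,\bar\epsilon]$, then the total number of oracle queries it utilizes is bounded by $$\mathcal{O}\Big(\frac{D}{\hat\epsilon}\cdot\frac{-\ln(\beta(1-\beta))}{\beta'\beta^4}\Big).$$
   Context: Operators map $\mathcal{E}$ to $\mathcal{E}$ in items 1 and 2, and $\mathcal{C}$ to $\mathcal{C}$ in item 3. $T$ is $\gamma$-Lipschitz if $\|T(x)-T(y)\|\le\gamma\|x-y\|$ for all $x,y$ in its domain. A fixed point satisfies $T(x_* )=x_*$. An oracle query is one evaluation of $T$. AdaGHAL. Input: $\epsilon>0$, $x_0$, $\beta,\beta'\in(0,1)$. Initialize $\epsilon_0=D_0=\|T(x_0)-x_0\|$, $k=0$, $\hat x_0=x_0$. While $\|T(\hat x_k)-\hat x_k\|>\epsilon$ (outer loop): set $k\leftarrow k+1$, $D_k=D_{k-1}$, $\epsilon_k=\beta\epsilon_{k-1}$, $\lambda_k\leftarrow\frac{\beta\epsilon_k/D_k}{1+\beta\epsilon_k/D_k}$ (Type (1) update), $y_0\leftarrow\hat x_{k-1}$, $j\leftarrow0$; while $\|T(y_j)-y_j\|>\epsilon_k$ (inner loop): set $y_{j+1}=\lambda_ky_0+(1-\lambda_k)T(y_j)$; if $j\ge1$ and $\|y_{j+1}-y_j\|\ge(1-\beta'\lambda_k)\|y_j-y_{j-1}\|$ (safeguard), halt the whole algorithm and return as $\hat x_k$ whichever of $y_j,y_0$ has the smaller residual $\|T(\cdot)-\cdot\|$;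 if $\max\{\|y_j-y_0\|,\|T(y_j)-y_0\|\}\le D_k$, set $j\leftarrow j+1$; else set $D_k\leftarrow D_k/\beta$, $\lambda_k\leftarrow\frac{\beta\epsilon_k/D_k}{1+\beta\epsilon_k/D_k}$ (Type (2) update), set $y_0$ to whichever of $y_{j+1},y_0$ has the smaller residual $\|T(\cdot)-\cdot\|$, and $j\leftarrow0$. When the inner loop ends, set $\hat x_k\leftarrow y_j$. When the outer loop ends, return $\hat x_k$. In the claim, $k$ is the outer-loop index when the algorithm stops, and $\epsilon_{k-1}$, $D_k$ are the corresponding quantities of the algorithm. $f=\mathcal{O}(g)$ means that there is a constant $C>0$, independent of $f,g$, with $f\le Cg$.
   Formalization: In items 2 and 3 the O-constant is uniform only over β≤b for each fixed b<1; the query bounds of items 1 and 2 assume ‖T(x0)−x0‖>ε (and γ>0 in item 1); the strict bound on ε_{k−1} is claimed only when the safeguard halts the run, otherwise the residual is ≤ε. *)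

(* Defs.v *)
(* MathComp-Analysis; the ground field is an arbitrary [R : realType]. *)
From HB Require Import structures.
From mathcomp Require Import all_boot all_order all_algebra.
From mathcomp Require Import all_classical all_reals all_analysis.
Import Order.TTheory GRing.Theory Num.Theory.
Import numFieldNormedType.Exports.

Set Implicit Arguments.
Unset Strict Implicit.
Unset Printing Implicit Defensive.

Local Open Scope classical_set_scope.
Local Open Scope ring_scope.

Definition residual (R : realType) (E : normedModType R) (T : E -> E) (x : E)
  : R := `|T x - x|.

(* "Whichever of u, v has the smaller residual": [pick] is any selection rule
   of this kind, so that ties may be broken in an arbitrary way. *)
Definition picks_smaller (R : realType) (E : normedModType R) (T : E -> E)
    (pick : E -> E -> E) : Prop :=
  forall u v, (pick u v = u \/ pick u v = v) /\
    residual T (pick u v) <= Num.min (residual T u) (residual T v).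

Inductive phase := OuterTest | InnerTest | Converged | Safeguarded.

(* At [OuterTest], [Converged] and [Safeguarded], [ag_y] holds the point
   \hat x_k of the algorithm. *)
Record state (R : realType) (E : normedModType R) := State {
  ag_phase : phase;
  ag_k : nat;      (* k *)
  ag_D : R;        (* D_k *)
  ag_y0 : E;       (* y_0 *)
  ag_yprev : E;    (* y_{j-1}, meaningful only for j > 0 *)
  ag_y : E;        (* y_j *)
  ag_j : nat;      (* j *)
  ag_queries : nat }.

(* epsilon_k *)
Fixpoint tol (R : realType) (E : normedModType R) (T : E -> E) (beta : R)
    (x0 : E) (k : nat) : R :=
  if k is k'.+1 then beta * tol T beta x0 k' else residual T x0.

(* The step size lambda_k; both types of update recompute it from the current
   epsilon_k and D_k by this formula. *)
Definition stepsize (R : realType) (beta epsk Dk : R) : R :=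
  (beta * epsk / Dk) / (1 + beta * epsk / Dk).

Definition adaghal_init (R : realType) (E : normedModType R) (T : E -> E)
    (x0 : E) : state E :=
  State OuterTest 0 (residual T x0) x0 x0 x0 0 1.

(* One pass through a loop test and the code it guards. T is evaluated once at
   x_0 and once at every new iterate y_{j+1} that survives the safeguard (its
   residual is needed next, whether j is incremented or y_0 is reset); these
   values are remembered, so that no other evaluation is ever needed. *)
Definition adaghal_step (R : realType) (E : normedModType R) (T : E -> E)
    (pick : E -> E -> E) (beta beta' eps : R) (x0 : E) (s : state E)
    : state E :=
  let: State ph k D y0 yp y j q := s in
  match ph with
  | OuterTest =>
      if residual T y <= eps then State Converged k D y0 yp y j q
      else State InnerTest k.+1 D y y y 0 q
  | InnerTest =>
      let epsk := tol T beta x0 k in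
      let lam := stepsize beta epsk D in
      let y' := lam *: y0 + (1 - lam) *: T y in
      if residual T y <= epsk then State OuterTest k D y0 yp y j q
      else if (1 <= j)%N && (`|y' - y| >= (1 - beta' * lam) * `|y - yp|)
      then State Safeguarded k D y0 yp (pick y y0) j q
      else if Num.max `|y - y0| `|T y - y0| <= D
      then State InnerTest k D y0 y y' j.+1 q.+1
      else let a := pick y' y0 in State InnerTest k (D / beta) a a a 0 q.+1
  | Converged | Safeguarded => s
  end.

(* The algorithm terminates, and [s] is its final state. *)
Definition adaghal_outputs (R : realType) (E : normedModType R) (T : E -> E)
    (pick : E -> E -> E) (beta beta' eps : R) (x0 : E) (s : state E) : Prop :=
  (exists n : nat,
     s = iter n (adaghal_step T pick beta beta' eps x0) (adaghal_init T x0)) /\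
  (ag_phase s = Converged \/ ag_phase s = Safeguarded).

(* Main.v *)
Require Import Defs.
From HB Require Import structures.
From mathcomp Require Import all_boot all_order all_algebra.
From mathcomp Require Import all_classical all_reals all_analysis.
From mathcomp Require Import zify lra ring.
Import Order.TTheory GRing.Theory Num.Theory.
Import numFieldNormedType.Exports.

Set Implicit Arguments.
Unset Strict Implicit.
Unset Printing Implicit Defensive.

Local Open Scope classical_set_scope.
Local Open Scope ring_scope.

(** Write [t = beta * eps_k / D_k], so that [lambda_k = t / (1 + t)] and
    [1 / t] is multiplied by [1 / beta] at every update of either type. Between
    two updates the algorithm is a Halpern iteration
    [y' = w *: y0 + (1 - w) *: T y] whose increments [`|y' - y|] shrink at each
    step at least by the factor [c = min (gamma * (1 - w)) (1 - beta' * w)]: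
    the first bound is the Lipschitz property, the second is the safeguard. Since
    [(1 - w) * `|T y - y| <= `|y' - y| + w * `|y - y0|] and the radius test
    keeps [w * `|y - y0|] below [(1 - w) * beta * eps_k], a query at index [j]
    requires [c ^ j > beta * (1 - beta)] ([query_rate]), so a run between two
    updates has length at most about [L / (- ln c)], with
    [L = - ln (beta * (1 - beta))]. A safeguard halt compares the two bounds on
    the increments and gives [t * (1 - beta') <= gamma - 1] ([safeguard_rate]).

    On an invariant convex set of diameter [Delta], radii stay below
    [Delta / beta], and a run costs [O (L / t)] queries (divided by [beta'] if
    only the safeguard makes the increments shrink). As [1 / t] grows
    geometrically with ratio [1 / beta], the total is dominated by the last
    run, up to the factor [1 / (1 - beta)]. This covers an expansive map
    ([expansive_regime]), and a nonexpansive map with a fixed point, on the ball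
    around the fixed point through [x0] ([nonexpansive_regime]).

    For a contraction, with [g = - ln gamma], [l = - ln beta] and [r0] the
    initial residual, there are at most [1 + ln (r0 / eps) / l] outer loops,
    and the run that ends a loop costs at most [1 + L / g]. Two points keep the
    constant free of [beta].

    - A run that ends in a radius update must travel far while its residual
      decreases little. This forces
      [1 / t < 4 (1 - beta) / (beta ^ 2 (1 - gamma))] ([exit_invrate]). Such a
      run costs [O ((1 + L / (1 + g)) / t)], and the factor [1 - beta] in the
      bound on [1 / t] absorbs the factor [1 / (1 - beta)] of the geometric
      sum. The values of [1 / t] within a factor [1 / beta ^ 2] of the bound,
      at most two of them, are charged [1 + L / g] each, which removes the
      factor [1 / beta ^ 2]. Both are recorded by a bounded [potential].
    - The summand 1 in the cost [1 + L / g] of a loop matters only for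
      small [gamma]. A loop whose last run makes at least one query either has
      [t > gamma], hence [k < g / l], or multiplies the residual by at most
      [2 * gamma], which happens [O (ln (r0 / eps) / g)] times. Two ghost
      counters [a] and [b] in [contractive_inv] track these two cases. *)

(** * The Halpern step *)

Section HalpernStep.
Context (R : realType) (E : normedModType R) (T : E -> E).
Implicit Types (lam : R) (y z u : E).

(** The Halpern step from [y], anchored at [u]. *)
Definition halpern lam u y : E := lam *: u + (1 - lam) *: T y.

Lemma halpern_subl lam u y : halpern lam u y - u = (1 - lam) *: (T y - u).
Proof.
rewrite /halpern scalerBr !scalerBl !scale1r.
rewrite opprB; set c := T y - _.
by rewrite [RHS]addrA [c + _]addrC.
Qed.

Lemma norm_halpern_subl lam u y : lam <= 1 ->
  `|halpern lam u y - u| = (1 - lam) * `|T y - u|.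
Proof. by move=> l1; rewrite halpern_subl normrZ ger0_norm // subr_ge0. Qed.

Lemma residual_le_halpern lam u y : 0 <= lam -> lam <= 1 ->
  (1 - lam) * residual T y <= `|halpern lam u y - y| + lam * `|y - u|.
Proof.
move=> l0 l1; have -> : (1 - lam) * residual T y = `|(1 - lam) *: (T y - y)|.
  by rewrite normrZ ger0_norm // subr_ge0.
rewrite -[X in _ <= _ + X * _](ger0_norm l0) -normrZ.
suff -> : (1 - lam) *: (T y - y) = (halpern lam u y - y) + lam *: (y - u).
  exact: ler_normD.
rewrite /halpern !scalerBr !scalerBl !scale1r opprB.
move: (lam *: u) (T y - _) (lam *: y) => a c b.
rewrite [a + c]addrC -[c + a - y]addrA -addrA.
by rewrite [a - y + _]addrC subrKA.
Qed.

Lemma halpern_sub lam u y z :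
  halpern lam u y - halpern lam u z = (1 - lam) *: (T y - T z).
Proof. by rewrite /halpern opprD addrACA subrr add0r scalerBr. Qed.

End HalpernStep.

(** * The step size *)

Section StepSize.
Context (R : realType).
Implicit Types (t : R).

Lemma weight_gt0 t : 0 < t -> 0 < t / (1 + t).
Proof. by move=> t0; apply: divr_gt0 => //; lra. Qed.

Lemma one_sub_weight t : 0 < t -> 1 - t / (1 + t) = (1 + t)^-1.
Proof. by move=> t0; field; lra. Qed.

Lemma weight_lt1 t : 0 < t -> t / (1 + t) < 1.
Proof. by move=> t0; rewrite -subr_gt0 one_sub_weight // invr_gt0; lra. Qed.

Lemma weight_sub t : 0 < t -> t / (1 + t) = t * (1 - t / (1 + t)).
Proof. by move=> t0; rewrite one_sub_weight. Qed.
End StepSize.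

(** * A potential for the restarts *)

Section Potential.
Context (R : realType) (b S U A : R).
Context (b_gt0 : 0 < b) (b_lt1 : b < 1) (S_ge0 : 0 <= S) (U_ge0 : 0 <= U)
  (A_ge0 : 0 <= A).

(** If a jump [s -> s / b] with [s < S] costs at most [U * s] and at most [A],
    this potential pays for it: the first summand telescopes the geometric
    costs [U * s] for [s <= b ^ 2 * S], and the second one pays [A] for
    each larger value, which passes one of the three thresholds. The factor
    [b ^ 2] in the bound [potential_le] comes from stopping the geometric part
    early. *)
Definition potential (s : R) : R :=
  U * b / (1 - b) * Num.min s (b * S)
  + A * ((b ^+ 2 * S < s)%R + (b * S < s)%R + (S < s)%R)%N%:R.

Let slope_ge0 : 0 <= U * b / (1 - b).
Proof. by rewrite divr_ge0 ?subr_ge0 ?(ltW b_lt1) // mulr_ge0 // ltW. Qed.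

Lemma potential_mono s s' : s <= s' -> potential s <= potential s'.
Proof.
move=> ss'; apply: lerD; apply: ler_wpM2l => //.
  by rewrite le_min !ge_min ss' lexx orbT.
have mono (x : R) : ((x < s)%R <= (x < s')%R)%N.
  by case: ltP => // /lt_le_trans/(_ ss') ->.
by rewrite ler_nat !leq_add.
Qed.

Lemma potential_le s : potential s <= U * b ^+ 2 * S / (1 - b) + 3 * A.
Proof.
apply: lerD; last first.
  rewrite mulrC ler_wpM2r // ler_nat.
  by do 3 case: (_ < s).
apply: (@le_trans _ _ (U * b / (1 - b) * (b * S))).
  by rewrite ler_wpM2l // ge_min lexx orbT.
rewrite le_eqVlt; apply/orP; left; apply/eqP; field.
by rewrite subr_eq0 gt_eqF.
Qed.

Lemma potential_ge0 s : 0 <= s -> 0 <= potential s.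
Proof.
move=> s0; apply: addr_ge0; apply: mulr_ge0 => //.
by rewrite le_min s0 mulr_ge0 // ltW.
Qed.

Lemma potential_jump s x : 0 < s -> s < S -> x <= U * s -> x <= A ->
  potential s + x <= potential (s / b).
Proof.
move=> s0 sS xU xA; have b1 : 0 < 1 - b by rewrite subr_gt0.
have ss : s <= s / b by rewrite ler_pdivlMr // ger_pMr // ltW.
have mono (z : R) : ((z < s)%R <= (z < s / b)%R)%N.
  by case: ltP => // /lt_le_trans/(_ ss) ->.
have bS : b * S <= S by rewrite ger_pMl ?(ltW b_lt1) // (lt_trans s0).
have bbS : b ^+ 2 * S <= b * S.
  by rewrite expr2 -mulrA ger_pMl ?(ltW b_lt1) // mulr_gt0 // (lt_trans s0).
have [sle|slt] := leP s (b ^+ 2 * S).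
  rewrite /potential addrAC; apply: lerD; last first.
    by rewrite ler_wpM2l // ler_nat !leq_add.
  rewrite (min_idPl (le_trans sle bbS)).
  have -> : Num.min (s / b) (b * S) = s / b.
    by apply/min_idPl; rewrite ler_pdivrMr // mulrAC -expr2.
  have -> : U * b / (1 - b) * (s / b) = U * b / (1 - b) * s + U * s.
    by field; rewrite subr_eq0 !gt_eqF.
  by rewrite lerD2l.
rewrite /potential -addrA; apply: lerD.
  by rewrite ler_wpM2l // le_min !ge_min ss lexx orbT.
apply: le_trans (lerD (lexx _) xA) _; rewrite -[X in _ + X]mulr1 -mulrDr.
rewrite ler_wpM2l // natr1 ler_nat.
have lt1 : b * S < s / b by rewrite ltr_pdivlMr // mulrAC -expr2.
(* Passing from s to s / b exceeds at least one more threshold. *)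
rewrite slt lt1 (le_lt_trans bbS lt1) [S < s]ltNge (ltW sS) /=.
case: ltP => [lt2|_] //.
by have -> : S < s / b by rewrite ltr_pdivlMr // mulrC.
Qed.

End Potential.

(** * The structural invariant *)

Section Run.
Context (R : realType) (E : normedModType R) (T : E -> E)
  (pick : E -> E -> E) (beta beta' eps gamma : R) (x0 : E) (C : set E).
(** [C] is a convex set containing [x0], invariant under [T], on which [T] is
    [gamma]-Lipschitz; [eps_lt] excludes a run without any outer loop. *)
Context (pickP : picks_smaller T pick)
  (beta_gt0 : 0 < beta) (beta_lt1 : beta < 1)
  (beta'_gt0 : 0 < beta') (beta'_lt1 : beta' < 1) (eps_gt0 : 0 < eps)
  (gamma_ge0 : 0 <= gamma)
  (Cx0 : C x0) (CT : forall x, C x -> C (T x))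
  (Cconv : forall (lam : R) u v, 0 <= lam -> lam <= 1 -> C u -> C v ->
     C (lam *: u + (1 - lam) *: v))
  (Tlip : forall x y, C x -> C y -> `|T x - T y| <= gamma * `|x - y|)
  (eps_lt : eps < residual T x0).

Let res := residual T.
Let r0 := residual T x0.
Let tolk := tol T beta x0.
Let step := adaghal_step T pick beta beta' eps x0.

(** [rate] is the number [t] such that the step size is [t / (1 + t)], and
    [weight] is that step size, for the outer index [k] and the radius [D]. *)
Definition rate k D : R := beta * tol T beta x0 k / D.
Definition weight k D : R := stepsize beta (tol T beta x0 k) D.
(** The factor by which consecutive increments of a run shrink, as long as the
    safeguard does not stop it. *)
Definition contr k D : R :=
  Num.min (gamma * (1 - weight k D)) (1 - beta' * weight k D).

Lemma r0_gt0 : 0 < r0. Proof. exact: lt_trans eps_lt. Qed.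

Lemma tolE k : tolk k = beta ^+ k * r0.
Proof. by elim: k => [|k IH]; rewrite ?mul1r // exprS -mulrA -IH. Qed.

Lemma tol_gt0 k : 0 < tolk k.
Proof. by rewrite tolE mulr_gt0 ?exprn_gt0 // r0_gt0. Qed.

Lemma tol_le_r0 k : tolk k <= r0.
Proof.
by rewrite tolE ler_piMl ?(ltW r0_gt0) // exprn_ile1 // ltW.
Qed.

Lemma tol_pred k : (0 < k)%N -> tolk k = beta * tolk k.-1.
Proof. by case: k. Qed.

Lemma beta_tol_pred k : beta * tolk k.-1 <= tolk k.
Proof.
case: k => //=; rewrite ger_pMl ?tol_gt0 //; exact: ltW.
Qed.

Lemma tol_le_pred k : tolk k <= tolk k.-1.
Proof.
case: k => //= k; rewrite ger_pMl ?tol_gt0 //; exact: ltW.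
Qed.

Section FixedRadius.
Context (k : nat) (D : R) (r0D : r0 <= D).

Let t := rate k D.
Let w := weight k D.
Let c := contr k D.

Lemma radius_gt0 : 0 < D. Proof. exact: lt_le_trans r0_gt0 r0D. Qed.

Lemma rate_gt0 : 0 < t.
Proof. by rewrite divr_gt0 ?radius_gt0 // mulr_gt0 ?tol_gt0. Qed.

Lemma rate_le : t <= beta ^+ k.+1.
Proof.
rewrite ler_pdivrMr ?radius_gt0 // -/(tolk k) tolE mulrA -exprS.
by rewrite ler_wpM2l // exprn_ge0 // ltW.
Qed.

Lemma rate_lt1 : t < 1.
Proof. by apply: le_lt_trans rate_le _; rewrite exprn_ilt1 // ltW. Qed.

Lemma weightE : w = t / (1 + t). Proof. by []. Qed.

Lemma weight_itv : 0 < w < 1.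
Proof. by rewrite weightE weight_gt0 ?rate_gt0 // weight_lt1 ?rate_gt0. Qed.

Lemma weight_rate : w = t * (1 - w).
Proof. by rewrite weightE {1}weight_sub // rate_gt0. Qed.

Lemma rate_radius : t * D = beta * tolk k.
Proof. by rewrite mulfVK // gt_eqF // radius_gt0. Qed.

Lemma contr_le_lip : c <= gamma * (1 - w).
Proof. by rewrite /c /contr ge_min lexx. Qed.

Lemma contr_le_safe : c <= 1 - beta' * w.
Proof. by rewrite /c /contr ge_min lexx orbT. Qed.

Lemma contr_ge0 : 0 <= c.
Proof.
have /andP[w0 w1] := weight_itv.
rewrite /c /contr le_min -/w mulr_ge0 ?subr_ge0 ?(ltW w1) //=.
by apply: mulr_ile1; rewrite ?ltW.
Qed.

Lemma contr_lt1 : c < 1.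
Proof.
apply: le_lt_trans contr_le_safe _.
by have /andP[w0 w1] := weight_itv; rewrite ltrBlDr ltrDl mulr_gt0.
Qed.

(** What holds at an inner test with anchor [y0], current point [y] and
    previous point [yp]. The field [inv_near] follows, for [j > 0], from the
    radius test of the previous point, and [inv_spread] bounds the distance to
    the anchor by the geometric sum of the increments. *)
Record inner_inv (y0 yp y : E) (j : nat) : Prop := {
  inv_k : (0 < k)%N;
  inv_C0 : C y0;
  inv_C : C y;
  inv_res0 : res y0 <= tolk k.-1;
  inv_eps : eps < tolk k.-1;
  inv_near : `|y - y0| <= (1 - w) * D;
  inv_spread : (1 - c) * `|y - y0| <= (1 - w) * (1 - c ^+ j) * res y0;
  inv_start : j = 0%N -> y = y0;
  inv_last : (0 < j)%N -> [/\ C yp, y = halpern T w y0 yp &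
    `|y - yp| <= c ^+ j.-1 * (1 - w) * res y0] }.

(** The safeguard condition, in non-strict form. *)
Definition safe (y0 yp y : E) (j : nat) : Prop :=
  (0 < j)%N -> `|halpern T w y0 y - y| <= (1 - beta' * w) * `|y - yp|.

Context (y0 yp y : E) (j : nat) (inv : inner_inv y0 yp y j).
Let y' := halpern T w y0 y.

Lemma res_ge0 x : 0 <= res x. Proof. exact: normr_ge0. Qed.

Lemma halpern_closed : C y'.
Proof.
have /andP[w0 w1] := weight_itv.
by apply: Cconv; rewrite ?ltW //; [exact: inv_C0 inv|apply/CT/(inv_C inv)].
Qed.

Lemma residual_le_increment : (1 - w) * res y <= `|y' - y| + w * `|y - y0|.
Proof. by have /andP[w0 w1] := weight_itv; apply: residual_le_halpern; exact: ltW. Qed.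

Lemma increment_lip : (0 < j)%N -> `|y' - y| <= gamma * (1 - w) * `|y - yp|.
Proof.
move=> /(inv_last inv)[Cp yE _].
rewrite {1}yE /y' halpern_sub normrZ.
have /andP[w0 w1] := weight_itv.
rewrite ger0_norm ?subr_ge0 ?(ltW w1) // [gamma * _]mulrC -mulrA.
by rewrite ler_wpM2l ?subr_ge0 ?(ltW w1) // Tlip //; exact: inv_C inv.
Qed.

(** The [j]-th increment of a run is at most [c ^ j] times the first one. *)
Lemma increment_contr : safe y0 yp y j -> `|y' - y| <= c ^+ j * (1 - w) * res y0.
Proof.
have /andP[w0 w1] := weight_itv.
case: (posnP j) => [j0 _|j0 /(_ j0) saf].
  rewrite j0 mul1r /y' (inv_start inv j0).
  by rewrite norm_halpern_subl // ltW.
have [_ _ yp_le] := inv_last inv j0.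
apply: (@le_trans _ _ (c * `|y - yp|)).
  by rewrite /c /contr minr_pMl ?le_min ?increment_lip.
rewrite -(prednK j0) exprS -!mulrA ler_wpM2l ?contr_ge0 // mulrA.
exact: yp_le.
Qed.

(** The length of a run is bounded because its residual stays above the
    tolerance, whereas the residual at the anchor is at most the previous
    tolerance. *)
Lemma query_rate : safe y0 yp y j -> tolk k < res y -> beta * (1 - beta) < c ^+ j.
Proof.
move=> saf resy; have /andP[w0 w1] := weight_itv.
have w1' : 0 < 1 - w by rewrite subr_gt0.
have H := le_trans residual_le_increment (lerD (increment_contr saf)
  (ler_wpM2l (ltW w0) (inv_near inv))).
have /(ler_wpM2l (ltW w1'))/(ler_wpM2l (exprn_ge0 j contr_ge0)) := inv_res0 inv.
move: resy; rewrite -(ltr_pM2l w1') => /lt_le_trans/(_ H).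
have H0 : w * ((1 - w) * D) <= (1 - w) * (beta * tolk k).
  rewrite mulrCA ler_wpM2l ?(ltW w1') // -rate_radius.
  rewrite ler_wpM2r ?(ltW radius_gt0) // weight_rate ger_pMr ?rate_gt0 //.
  by rewrite gerBl ltW.
rewrite -/c => H1 H2.
have : (1 - w) * tolk k.-1 * (beta * (1 - beta)) < (1 - w) * tolk k.-1 * c ^+ j.
  move: H0 H1 H2; rewrite (tol_pred (inv_k inv)).
  move: (c ^+ j) (res y0) (tolk _) => P r e; nra.
by rewrite ltr_pM2l // mulr_gt0 ?tol_gt0.
Qed.

Lemma spread_next : safe y0 yp y j ->
  (1 - c) * `|y' - y0| <= (1 - w) * (1 - c ^+ j.+1) * res y0.
Proof.
move=> saf; have tri : `|y' - y0| <= `|y' - y| + `|y - y0|.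
  by rewrite -(subrKA y y' (- y0)) ler_normD.
have c1 : 0 <= 1 - c by rewrite subr_ge0 ltW // contr_lt1.
apply: le_trans (ler_wpM2l c1 tri) _.
have := ler_wpM2l c1 (increment_contr saf); have := inv_spread inv.
rewrite exprS -/c; lra.
Qed.

Lemma norm_next_subl : `|y' - y0| = (1 - w) * `|T y - y0|.
Proof. by have /andP[_ w1] := weight_itv; rewrite norm_halpern_subl // ltW. Qed.

Lemma inner_inv_next : safe y0 yp y j -> `|T y - y0| <= D ->
  inner_inv y0 y y' j.+1.
Proof.
move=> saf TyD; have /andP[w0 w1] := weight_itv.
split=> //; [exact: inv_k inv|exact: inv_C0 inv|exact: halpern_closed
  |exact: inv_res0 inv|exact: inv_eps inv| |exact: spread_next|].
  by rewrite norm_next_subl ler_wpM2l // subr_ge0 ltW.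
by move=> _; split=> //; [exact: inv_C inv|exact: increment_contr].
Qed.

Lemma near_radius : `|y - y0| <= D.
Proof.
have /andP[w0 w1] := weight_itv; apply: le_trans (inv_near inv) _.
by rewrite ger_pMl ?radius_gt0 // gerBl ltW.
Qed.

(** Only the distance from [T y] to the anchor can trigger a radius update, and
    not at the anchor itself, whose residual is at most the initial one. *)
Lemma exit_gt0 : D < Num.max `|y - y0| `|T y - y0| ->
  D < `|T y - y0| /\ (0 < j)%N.
Proof.
rewrite lt_max ltNge near_radius /= => DT; split=> //.
rewrite lt0n; apply/eqP => j0; move: DT; rewrite (inv_start inv j0) ltNge.
by rewrite (le_trans (inv_res0 inv)) // (le_trans (tol_le_r0 _)).
Qed.

(** A radius update requires the geometric sum of the increments to exceed
    the radius. *)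
Lemma exit_radius : safe y0 yp y j -> D < `|T y - y0| ->
  D * (1 - c) < (1 - c ^+ j.+1) * res y0.
Proof.
move=> saf DT; have /andP[w0 w1] := weight_itv.
have c1 : 0 < 1 - c by rewrite subr_gt0 contr_lt1.
have w1' : 0 < 1 - w by rewrite subr_gt0.
have := spread_next saf; rewrite norm_next_subl mulrCA -mulrA ler_pM2l //.
by apply: lt_le_trans; rewrite mulrC ltr_pM2l.
Qed.

(** Combines the increment bound and the distance bound: the residual of the
    [j]-th point is at most a convex combination of that of the anchor and of
    its multiple by [w / (1 - c)], where the latter has weight [1 - c ^ j]. *)
Lemma residual_decay : safe y0 yp y j ->
  (1 - c) * res y <= ((1 - c) * c ^+ j + w * (1 - c ^+ j)) * res y0.
Proof.
move=> saf; have /andP[w0 w1] := weight_itv.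
have c1 : 0 <= 1 - c by rewrite subr_ge0 ltW // contr_lt1.
have w1' : 0 < 1 - w by rewrite subr_gt0.
rewrite -(ler_pM2l w1').
have := ler_wpM2l c1 residual_le_increment.
have := ler_wpM2l c1 (increment_contr saf).
have := ler_wpM2l (ltW w0) (inv_spread inv); rewrite -/c; lra.
Qed.

(** The safeguard stops a run only if [1 - beta' * w <= gamma * (1 - w)], which
    is the conclusion after multiplication by [1 + t]. *)
Lemma safeguard_rate : (0 < j)%N -> tolk k < res y ->
  (1 - beta' * w) * `|y - yp| <= `|y' - y| -> t * (1 - beta') <= gamma - 1.
Proof.
move=> j0 resy saf; have /andP[w0 w1] := weight_itv.
have w1' : 0 < 1 - w by rewrite subr_gt0.
have lip := increment_lip j0.
(* A zero increment would already give a residual below the tolerance. *)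
have yyp : 0 < `|y - yp|.
  rewrite lt_neqAle normr_ge0 andbT; apply/eqP => d0.
  move: lip; rewrite -d0 mulr0 => lip.
  move: resy; rewrite ltNge -(ler_pM2l w1') => /negP; apply.
  apply: le_trans residual_le_increment _.
  apply: le_trans (lerD lip (ler_wpM2l (ltW w0) (inv_near inv))) _.
  rewrite add0r mulrCA ler_wpM2l ?(ltW w1') //.
  apply: (@le_trans _ _ (t * D)).
    rewrite ler_wpM2r ?(ltW radius_gt0) // weight_rate ger_pMr ?rate_gt0 //.
    by rewrite gerBl ltW.
  by rewrite rate_radius ger_pMl ?tol_gt0 // ltW.
have t1 : 0 < 1 + t by rewrite addr_gt0 // rate_gt0.
have wt : w * (1 + t) = t by rewrite weightE divfK // gt_eqF.
have := le_trans saf lip; rewrite ler_pM2r // -(ler_pM2r t1).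
by rewrite mulrBl mul1r -mulrA wt -mulrA mulrBl mul1r wt; lra.
Qed.

End FixedRadius.

Lemma inner_inv_start k D a : r0 <= D -> (0 < k)%N -> C a ->
  res a <= tolk k.-1 -> eps < tolk k.-1 -> inner_inv k D a a a 0.
Proof.
move=> r0D k0 Ca resa epsk; split=> //; rewrite subrr normr0.
  have /andP[_ w1] := weight_itv k r0D.
  by rewrite mulr_ge0 ?subr_ge0 ?(ltW w1) // ltW // (radius_gt0 r0D).
by rewrite expr0 subrr !(mulr0, mul0r).
Qed.

(** The four outcomes of an inner test, with the conditions that select them. *)
Variant inner_step k D y0 yp y j q : state E -> Prop :=
| InnerDone of res y <= tolk k :
    inner_step k D y0 yp y j q (State OuterTest k D y0 yp y j q)
| InnerSafeguard of tolk k < res y & (0 < j)%N &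
    (1 - beta' * weight k D) * `|y - yp|
      <= `|halpern T (weight k D) y0 y - y| :
    inner_step k D y0 yp y j q (State Safeguarded k D y0 yp (pick y y0) j q)
| InnerNext of tolk k < res y & safe k D y0 yp y j & `|T y - y0| <= D :
    inner_step k D y0 yp y j q
      (State InnerTest k D y0 y (halpern T (weight k D) y0 y) j.+1 q.+1)
| InnerReset a of tolk k < res y & safe k D y0 yp y j &
    D < Num.max `|y - y0| `|T y - y0| &
    a = pick (halpern T (weight k D) y0 y) y0 :
    inner_step k D y0 yp y j q (State InnerTest k (D / beta) a a a 0 q.+1).

Lemma inner_stepP k D y0 yp y j q :
  inner_step k D y0 yp y j q (step (State InnerTest k D y0 yp y j q)).
Proof.
rewrite /step /=; case: leP => [|resy]; first by constructor.
case: ifP => [/andP[j0 saf]|/negbT/nandP saf]; first exact: InnerSafeguard.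
have {}saf : safe k D y0 yp y j.
  by move=> j0; case: saf; [rewrite j0|rewrite -ltNge => /ltW].
case: leP => [|DT]; first by rewrite ge_max => /andP[_ TD]; exact: InnerNext.
exact: InnerReset.
Qed.

(** The invariant of all reachable states. At an outer test [eps < tolk k.-1]
    also holds for [k = 0], where the predecessor is 0. *)
Definition state_inv (s : state E) : Prop :=
  let: State ph k D y0 yp y j q := s in
  r0 <= D /\
  match ph with
  | OuterTest => [/\ C y, res y <= tolk k & eps < tolk k.-1]
  | InnerTest => inner_inv k D y0 yp y j
  | Converged =>
      [/\ C y, res y <= tolk k, res y <= eps & eps < tolk k.-1]
  | Safeguarded => [/\ C y, res y <= tolk k.-1, eps < tolk k.-1, (0 < k)%N &
      rate k D * (1 - beta') <= gamma - 1]
  end.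

Lemma pick_closed u v : C u -> C v -> C (pick u v).
Proof. by case: (pickP u v) => -[] ->. Qed.

Lemma res_pick u v : res (pick u v) <= res v.
Proof. by case: (pickP u v) => _ /le_trans; apply; rewrite ge_min lexx orbT. Qed.

Lemma state_inv_init : state_inv (adaghal_init T x0).
Proof. by split=> //=; split=> //; rewrite tolE mul1r. Qed.

Lemma radius_reset D : r0 <= D -> r0 <= D / beta.
Proof.
move=> r0D; apply: (le_trans r0D).
by rewrite ler_pdivlMr // ger_pMr ?(ltW beta_lt1) // (radius_gt0 r0D).
Qed.

Lemma state_inv_step s : state_inv s -> state_inv (step s).
Proof.
case: s => -[] k D y0 yp y j q // [r0D].
- move=> [Cy resy epsk]; rewrite /step /=; case: leP => resy'; split=> //.
  by apply: inner_inv_start => //=; exact: lt_le_trans resy.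
- move=> inv; case: inner_stepP => [resy|resy j0 saf|resy saf TD|a resy saf DT ->].
  + by split=> //; split=> //; [exact: inv_C inv|exact: inv_eps inv].
  + split=> //; split; [|exact: le_trans (res_pick _ _) (inv_res0 inv)
      |exact: inv_eps inv|exact: inv_k inv|exact: (safeguard_rate r0D inv j0 resy saf)].
    by apply: pick_closed; [exact: inv_C inv|exact: inv_C0 inv].
  + by split=> //; exact: (inner_inv_next r0D inv saf TD).
  + split; first exact: radius_reset.
    apply: inner_inv_start; [exact: radius_reset|exact: inv_k inv| |
      exact: le_trans (res_pick _ _) (inv_res0 inv)|exact: inv_eps inv].
    by apply: pick_closed; [exact: (halpern_closed r0D inv)|exact: inv_C0 inv].
Qed.

(** * Termination *)

(** The states that are not final. *)
Definition running (s : state E) : bool :=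
  match ag_phase s with OuterTest | InnerTest => true | _ => false end.

(** Every step either queries [T], opens an outer loop, or closes one. Hence
    the number of steps is controlled by the number of queries and of loops;
    the summand 1 stands for the loop that is still open. *)
Definition progress (n : nat) (s : state E) : Prop := running s ->
  (n + (if ag_phase s is InnerTest then 1 else 0)
     < ag_queries s + 2 * ag_k s)%N.

Lemma progress_step n s : progress n s -> progress n.+1 (step s).
Proof.
case: s => -[] k D y0 yp y j q //.
  rewrite /progress /running /= => /(_ isT) n_lt.
  by case: leP => //= _ _; rewrite mulnS; lia.
by move=> n_lt; case: inner_stepP => *; have := n_lt isT; rewrite /progress /=; lia.
Qed.

(** If [n] multiplications by [x] have not brought the initial residual below
    [eps], then [n] is bounded logarithmically. *)
Lemma pow_log x n : 0 < x -> eps < x ^+ n * r0 ->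
  n%:R * - ln x <= ln (r0 / eps).
Proof.
move=> x_gt0 epsx; have r00 := r0_gt0; have xn : 0 < x ^+ n by rewrite exprn_gt0.
rewrite mulrN lerNl mulr_natl -lnXn // -lnV ?posrE ?divr_gt0 // invf_div.
by rewrite ler_ln ?posrE ?divr_gt0 // ler_pdivrMr // ltW.
Qed.

Lemma loops_le k : eps < tolk k.-1 -> k.-1%:R * - ln beta <= ln (r0 / eps).
Proof. by rewrite tolE; exact: pow_log. Qed.

(** An invariant that bounds the number of queries ensures termination, since
    the number of outer loops is bounded in any case. *)
Lemma run_outputs (P : state E -> Prop) (Q : R) :
  P (adaghal_init T x0) -> (forall s, state_inv s -> P s -> P (step s)) ->
  (forall s, running s -> state_inv s -> P s -> (ag_queries s)%:R <= Q) ->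
  exists s, [/\ adaghal_outputs T pick beta beta' eps x0 s, state_inv s & P s].
Proof.
move=> P0 Pstep Pq; have lb : 0 < - ln beta by rewrite oppr_gt0 ln_lt0 ?beta_gt0.
pose K := ln (r0 / eps) / - ln beta + 1.
pose n := Num.bound (`|Q + 2 * K|).
pose s m := iter m step (adaghal_init T x0).
have inv m : state_inv (s m) /\ P (s m).
  elim: m => [|m [im Pm]]; first by split=> //; exact: state_inv_init.
  by split; [exact: state_inv_step|exact: Pstep].
have prog m : progress m (s m).
  by elim: m => [//|m]; exact: progress_step.
exists (s n); have [inv_n P_n] := inv n; split=> //; split; first by exists n.
have [run|] := boolP (running (s n)); last first.
  by rewrite /running; case: (ag_phase _) => //; [left|right].
exfalso; have qQ := Pq _ run inv_n P_n.
have nqk : (n < ag_queries (s n) + 2 * ag_k (s n))%N.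
  by apply: leq_ltn_trans (leq_addr _ _) (prog n run).
have kK : (ag_k (s n))%:R <= K.
  have /loops_le : eps < tolk (ag_k (s n)).-1.
    move: inv_n; case: (s n) => -[] k D y0 yp y j q [_] /=; by case.
  rewrite -ler_pdivlMr // /K; case: (ag_k (s n)) => [|k] /=; first by lra.
  by rewrite -natr1; lra.
have nlt : Q + 2 * K < n%:R.
  by apply: le_lt_trans (ler_norm _) (archi_boundP _).
have : n%:R < (ag_queries (s n))%:R + 2 * (ag_k (s n))%:R :> R.
  by rewrite -natrM -natrD ltr_nat.
lra.
Qed.

(** * The length of a run *)

(** The logarithm that bounds the length of a run, a number at least 1. *)
Definition query_log : R := - ln (beta * (1 - beta)).
Local Notation L := query_log.

Lemma beta_mul_gt0 : 0 < beta * (1 - beta).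
Proof. by rewrite mulr_gt0 // subr_gt0. Qed.

Lemma beta_mul_le : beta * (1 - beta) <= 4^-1.
Proof. have := sqr_ge0 (beta - 2^-1); rewrite expr2; lra. Qed.

Lemma log_ge1 : 1 <= L.
Proof.
rewrite /query_log lerNr -ler_expR lnK ?posrE ?beta_mul_gt0 //.
(* 1/4 = (1 - 1/2)^2 <= exp (-1/2)^2 = exp (-1). *)
apply: le_trans beta_mul_le _; have := expR_ge1Dx (- 2^-1 : R).
have -> : -1 = - 2^-1 + - 2^-1 :> R by lra.
rewrite expRD; set e := expR _; nra.
Qed.

(** If [c <= exp (- x)], the powers of [c] stay above [beta * (1 - beta)] for at
    most [L / x] exponents. *)
Lemma count_le (c x : R) (j : nat) : 0 <= c -> c <= expR (- x) ->
  beta * (1 - beta) < c ^+ j -> j%:R * x <= L.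
Proof.
move=> c0 cx cj; rewrite /query_log lerNr -ler_expR lnK ?posrE ?beta_mul_gt0 //.
apply: le_trans (ltW cj) _; rewrite -mulrN mulrC expRM_natr.
by rewrite lerXn2r ?nnegrE ?expR_ge0.
Qed.

(** The inverse of the rate; both types of update divide it by [beta]. *)
Definition invrate (k : nat) (D : R) : R := (rate k D)^-1.

Lemma invrate_ge1 k D : r0 <= D -> 1 <= invrate k D.
Proof.
by move=> r0D; rewrite invf_ge1 ?rate_gt0 // ltW // rate_lt1.
Qed.

Lemma invrate_gt0 k D : r0 <= D -> 0 < invrate k D.
Proof. by move/(invrate_ge1 k); exact: lt_le_trans. Qed.

Lemma invrateE k D : invrate k D = D / (beta * tolk k).
Proof. by rewrite /invrate /rate invf_div. Qed.

Lemma invrate_reset k D : invrate k (D / beta) = invrate k D / beta.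
Proof. by rewrite !invrateE mulrAC. Qed.

Lemma invrate_loop k D : invrate k.+1 D = invrate k D / beta.
Proof.
by rewrite !invrateE /= -/(tolk k) [beta * (beta * _)]mulrC invfM mulrA.
Qed.

(** The mixing weight is at least half its rate, as the rate is below one. *)
Lemma half_rate k D : r0 <= D -> rate k D <= 2 * weight k D.
Proof.
move=> r0D; have t0 := rate_gt0 k r0D; have t1 := rate_lt1 k r0D.
rewrite weightE mulrA ler_pdivlMr; nra.
Qed.

Lemma one_le_half_weight k D : r0 <= D -> 1 <= 2 * weight k D * invrate k D.
Proof.
move=> r0D; rewrite ler_pdivlMr ?rate_gt0 // mul1r; exact: half_rate.
Qed.

(** * Maps of a bounded convex set *)

Section Bounded.
(** [Delta] bounds the diameter of [C]. Increments shrink by a factor at most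
    [1 - theta * weight], where [theta] is [beta'] if this comes from the
    safeguard and 1 if it comes from nonexpansiveness. *)
Context (Delta theta : R)
  (diam : forall x y, C x -> C y -> `|x - y| <= Delta)
  (theta_gt0 : 0 < theta) (theta_le1 : theta <= 1)
  (thetaP : theta = beta' \/ theta = 1 /\ gamma <= 1).

(** A run has at most [run_const * invrate] queries. *)
Definition run_const : R := 3 * L / theta.
Local Notation G := run_const.

Lemma contr_le_theta k D : r0 <= D -> contr k D <= 1 - theta * weight k D.
Proof.
move=> r0D; case: thetaP => [->|[-> g1]]; first exact: contr_le_safe.
apply: le_trans (contr_le_lip _ _) _; have /andP[_ w1] := weight_itv k r0D.
by rewrite mul1r ger_pMl // subr_gt0.
Qed.

Lemma run_const_ge1 : 1 <= G.
Proof. by rewrite ler_pdivlMr // mul1r; have := log_ge1; have := theta_le1; lra. Qed.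

Lemma run_length k D j : r0 <= D -> beta * (1 - beta) < contr k D ^+ j ->
  j.+1%:R <= G * invrate k D.
Proof.
move=> r0D cj; have c0 := contr_ge0 k r0D; have s1 := invrate_ge1 k r0D.
have cle : contr k D <= expR (- (theta * weight k D)).
  by apply: le_trans (contr_le_theta k r0D) _; exact: expR_ge1Dx.
have jL := count_le c0 cle cj; have L1 := log_ge1.
rewrite /run_const mulrAC ler_pdivlMr // -natr1.
have ws := one_le_half_weight k r0D; have s0 := invrate_gt0 k r0D.
have H1 : j%:R * theta <= 2 * (j%:R * (theta * weight k D)) * invrate k D.
  have jt : 0 <= j%:R * theta :> R by rewrite mulr_ge0 // ltW.
  have := ler_wpM2l jt ws; rewrite mulr1; move: (weight k D) (invrate k D) => w s. lra.
have H2 : j%:R * (theta * weight k D) * invrate k D <= L * invrate k D.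
  by rewrite ler_wpM2r // ltW.
have := mulr_ege1 L1 s1; have := theta_le1; lra.
Qed.

(** Runs completed so far cost at most [run_const * invrate] summed over a
    geometric progression of [invrate] with ratio [1 / beta]; the sum up to and
    including the current value is [run_const / (1 - beta) * invrate]. *)
Definition bounded_inv (s : state E) : Prop :=
  let: State ph k D y0 yp y j q := s in
  D <= Delta / beta /\
  match ph with
  | InnerTest => q%:R <= G / (1 - beta) * beta * invrate k D + j%:R /\
      j%:R <= G * invrate k D
  | _ => q%:R <= G / (1 - beta) * invrate k D
  end.

Lemma radius_le_diam : r0 <= Delta.
Proof. by apply: diam => //; exact: CT. Qed.

Lemma bounded_inv_init : bounded_inv (adaghal_init T x0).
Proof.
have G1 := run_const_ge1.
split=> /=.
  apply: le_trans radius_le_diam _; rewrite ler_pdivlMr // ger_pMr ?(ltW beta_lt1) //.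
  exact: lt_le_trans r0_gt0 radius_le_diam.
have s1 := invrate_ge1 0 (lexx r0).
apply: mulr_ege1 => //; rewrite ler_pdivlMr ?subr_gt0 // mul1r.
by apply: le_trans G1; rewrite gerBl ltW.
Qed.

Lemma geom_split (x : R) :
  G / (1 - beta) * x = G / (1 - beta) * beta * x + G * x.
Proof. by field; rewrite subr_eq0 gt_eqF. Qed.

Lemma bounded_inv_step s : state_inv s -> bounded_inv s -> bounded_inv (step s).
Proof.
have bn0 : beta != 0 by rewrite gt_eqF.
case: s => -[] k D y0 yp y j q // [r0D].
- move=> [Cy resy epsk] [DD qs]; rewrite /step /=; case: leP => // _.
  split=> //; rewrite invrate_loop addr0; split.
    by rewrite -[_ * beta * _]mulrA [beta * _]mulrC divfK.
  have := invrate_ge1 k.+1 r0D; rewrite invrate_loop => s1.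
  by rewrite mulr_ge0 ?(le_trans ler01) // run_const_ge1.
- move=> inv [DD [qs js]].
  case: inner_stepP => [resy|resy j0 saf|resy saf TD|a resy saf DT _].
  + by split=> //; rewrite geom_split; lra.
  + by split=> //; rewrite geom_split; lra.
  + split=> //; rewrite -!natr1; split; first by lra.
    by rewrite natr1; apply: run_length => //; exact: query_rate saf resy.
  + have [DT' _] := exit_gt0 r0D inv DT; split.
      rewrite ler_wpM2r ?invr_ge0 ?(ltW beta_gt0) //.
      apply: le_trans (ltW DT') _; apply: diam; last exact: inv_C0 inv.
      by apply: CT; exact: inv_C inv.
    rewrite invrate_reset addr0; split.
      rewrite -[_ * beta * _]mulrA [beta * _]mulrC divfK // geom_split -natr1.
      have := run_length r0D (query_rate r0D inv saf resy); rewrite -natr1; lra.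
    have := invrate_ge1 k (radius_reset r0D); rewrite invrate_reset => s1.
    by rewrite mulr_ge0 ?(le_trans ler01) // run_const_ge1.
Qed.

Lemma invrate_le k D e : r0 <= D -> D <= Delta / beta -> 0 < e -> e <= tolk k.-1 ->
  invrate k D <= Delta / (beta ^+ 3 * e).
Proof.
move=> r0D DD e0 ek; have be := beta_tol_pred k.
have bek : beta * e <= tolk k by apply: le_trans be; rewrite ler_pM2l.
rewrite invrateE; apply: (@le_trans _ _ (Delta / beta / (beta * (beta * e)))).
  apply: ler_pM => //.
  - exact: ltW (radius_gt0 r0D).
  - by rewrite invr_ge0 mulr_ge0 ?(ltW (tol_gt0 _)) // ltW.
  - by rewrite lef_pV2 ?posrE ?mulr_gt0 ?tol_gt0 // ler_pM2l.
rewrite le_eqVlt; apply/orP; left; apply/eqP; field; rewrite !gt_eqF //.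
Qed.

Lemma bounded_queries s e : state_inv s -> bounded_inv s ->
  0 < e -> e <= tolk (ag_k s).-1 ->
  (ag_queries s)%:R <= G / (1 - beta) * (Delta / (beta ^+ 3 * e)).
Proof.
case: s => ph k D y0 yp y j q [r0D _] [DD qs] e0 ek.
have G0 : 0 <= G / (1 - beta).
  by rewrite divr_ge0 ?subr_ge0 ?(ltW beta_lt1) // (le_trans ler01 run_const_ge1).
apply: le_trans (ler_wpM2l G0 (invrate_le r0D DD e0 ek)).
by case: ph qs {ek} => // -[qs js]; rewrite /= geom_split; lra.
Qed.

Lemma bounded_outputs : exists s,
  [/\ adaghal_outputs T pick beta beta' eps x0 s, state_inv s & bounded_inv s].
Proof.
apply: (run_outputs bounded_inv_init bounded_inv_step).
move=> s run inv bnd; apply: (bounded_queries inv bnd eps_gt0).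
by move: run inv; case: s {bnd} => -[] k D y0 yp y j q //= _ [_] [] *; exact: ltW.
Qed.

End Bounded.

(** * Contractions *)

Section Contractive.
Context (gamma_gt0 : 0 < gamma) (gamma_lt1 : gamma < 1).

Local Notation g := (- ln gamma).
Local Notation l := (- ln beta).
Local Notation H := (ln (r0 / eps)).

Lemma neg_ln_gamma_gt0 : 0 < g. Proof. by rewrite oppr_gt0 ln_lt0 ?gamma_gt0. Qed.
Lemma neg_ln_beta_gt0 : 0 < l. Proof. by rewrite oppr_gt0 ln_lt0 ?beta_gt0. Qed.
Lemma ln_ratio_gt0 : 0 < H.
Proof. by rewrite ln_gt0 // ltr_pdivlMr // mul1r. Qed.

Lemma contr_contractive k D : r0 <= D ->
  contr k D = gamma * (1 - weight k D).
Proof.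
move=> r0D; have /andP[w0 w1] := weight_itv k r0D; apply/min_idPl.
apply: (@le_trans _ _ (1 - weight k D)).
  by rewrite ger_pMl ?(ltW gamma_lt1) // subr_gt0.
by rewrite lerD2l lerN2 ger_pMl // ltW.
Qed.

(** The safeguard never stops a contraction. *)
Lemma contractive_safe k D y0 yp y j : r0 <= D -> inner_inv k D y0 yp y j ->
  safe k D y0 yp y j.
Proof.
move=> r0D inv j0; apply: le_trans (increment_lip r0D inv j0) _.
by rewrite ler_wpM2r // -contr_contractive // contr_le_safe.
Qed.

Lemma contractive_length k D j : r0 <= D ->
  beta * (1 - beta) < contr k D ^+ j -> j%:R * (g + weight k D) <= L.
Proof.
move=> r0D; apply: count_le; first exact: contr_ge0.
rewrite contr_contractive // opprD opprK expRD lnK ?posrE //.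
by rewrite ler_wpM2l ?expR_ge1Dx.
Qed.

(** A run has at most [exit_cost * invrate] and at most [loop_cost] queries. *)
Definition exit_cost : R := 2 + 2 * L / (1 + g).
Definition loop_cost : R := 1 + L / g.

(** A run can end in a radius update only if [invrate] is below this bound. *)
Definition exit_bound : R := 4 * (1 - beta) / (beta ^+ 2 * (1 - gamma)).

Lemma run_length_log k D j : r0 <= D -> beta * (1 - beta) < contr k D ^+ j ->
  j.+1%:R <= loop_cost.
Proof.
move=> r0D /(contractive_length r0D) jL; have /andP[w0 _] := weight_itv k r0D.
rewrite -natr1 addrC lerD2l ler_pdivlMr ?neg_ln_gamma_gt0 //; apply: le_trans jL.
by rewrite ler_wpM2l // lerDl ltW.
Qed.

Lemma run_length_exit k D j : r0 <= D -> beta * (1 - beta) < contr k D ^+ j ->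
  j.+1%:R <= exit_cost * invrate k D.
Proof.
move=> r0D /(contractive_length r0D) jL; have g0 := neg_ln_gamma_gt0.
have ws := one_le_half_weight k r0D; have s1 := invrate_ge1 k r0D.
have j0 : 0 <= j%:R :> R by [].
rewrite -natr1 /exit_cost mulrDl; set x := _ / _ * _.
suff : j%:R <= x by lra.
rewrite /x mulrAC ler_pdivlMr ?addr_gt0 //.
have H1 := ler_wpM2l j0 ws.
have jg : 0 <= j%:R * g by rewrite mulr_ge0 // ltW.
have H2 := ler_wpM2l jg s1; have s0 := invrate_gt0 k r0D.
have H3 := ler_wpM2r (ltW s0) jL.
move: jL H1 H2 H3 jg; move: (weight k D) (invrate k D) => w s; lra.
Qed.

(** The bound on the residual after exactly one step of a run persists until
    the end of that run. *)
Lemma residual_decay_first k D y0 yp y j : r0 <= D ->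
  inner_inv k D y0 yp y j -> (0 < j)%N ->
  res y <= (contr k D + weight k D) * res y0.
Proof.
move=> r0D inv j0; have /andP[w0 w1] := weight_itv k r0D.
have := residual_decay r0D inv (contractive_safe r0D inv).
have c0 := contr_ge0 k r0D; have c1 := contr_lt1 k r0D.
have Pc : contr k D ^+ j <= contr k D.
  by rewrite -(prednK j0) exprS ler_piMr // exprn_ile1 // ltW.
have cw : 0 <= 1 - contr k D - weight k D.
  rewrite contr_contractive //.
  have : 0 <= (1 - gamma) * (1 - weight k D) by rewrite mulr_ge0 ?subr_ge0 ?ltW.
  lra.
have r_ge0 := res_ge0 y0.
move: Pc cw c1; move: (contr k D) (weight k D) (contr k D ^+ j) => c w P Pc cw c1.
move=> dec; have c1' : 0 < 1 - c by lra.
rewrite -(ler_pM2l c1'); apply: le_trans dec _; rewrite mulrA.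
apply: ler_wpM2r => //; nra.
Qed.

(** With [P = c ^ j], the residual at a radius update has not yet decreased by
    the factor [beta], so [(1 - gamma) (1 - w) (1 - P)] is less than
    [(1 - beta) (1 - c)]; and the distance travelled exceeds the radius, so
    [beta ^ 2 * invrate * (1 - c)] is less than [2 (1 - P)]. The factor [1 - P]
    cancels from the product of the two inequalities. *)
Lemma exit_invrate k D y0 yp y j : r0 <= D -> inner_inv k D y0 yp y j ->
  tolk k < res y -> D < Num.max `|y - y0| `|T y - y0| ->
  invrate k D < exit_bound.
Proof.
move=> r0D inv resy DT; have [DT' j0] := exit_gt0 r0D inv DT.
have saf := contractive_safe r0D inv.
have /andP[w0 w1] := weight_itv k r0D.
have dec := residual_decay r0D inv saf.
have rad := exit_radius r0D inv saf DT'.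
have c0 := contr_ge0 k r0D; have c1 := contr_lt1 k r0D.
have Pc : contr k D ^+ j <= contr k D.
  by rewrite -(prednK j0) exprS ler_piMr // exprn_ile1 // ltW.
have P0 : 0 <= contr k D ^+ j by rewrite exprn_ge0.
have cE := contr_contractive k r0D.
have e0 := tol_gt0 k.
have re : beta * res y0 <= tolk k.
  by rewrite (tol_pred (inv_k inv)) ler_pM2l // (inv_res0 inv).
have DE : D = beta * tolk k * invrate k D.
  by rewrite invrateE mulrC divfK // gt_eqF // mulr_gt0.
have whalf : 2 * weight k D <= 1.
  rewrite weightE mulrA ler_pdivrMr ?addr_gt0 ?rate_gt0 //.
  by have := rate_lt1 k r0D; lra.
have r_ge0 := res_ge0 y0.
have s0 := invrate_gt0 k r0D.
move: rad; rewrite exprS {1}DE => rad.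
rewrite /exit_bound ltr_pdivlMr; last by rewrite mulr_gt0 ?exprn_gt0 // subr_gt0.
move: (contr k D) (weight k D) (contr k D ^+ j) (invrate k D) (res y) (res y0) (tolk k)
  w0 w1 dec rad c0 c1 Pc P0 cE e0 re whalf r_ge0 s0 resy =>
  c w P s rho r e w0 w1 dec rad c0 c1 Pc P0 cE e0 re whalf r_ge0 s0 resy.
have c1' : 0 < 1 - c by lra.
have b1 : 0 < 1 - beta by rewrite subr_gt0.
have g1 : 0 < 1 - gamma by rewrite subr_gt0.
have h1 : (1 - c) * (beta * r) < ((1 - c) * P + w * (1 - P)) * r.
  apply: lt_le_trans dec; rewrite ltr_pM2l //; exact: le_lt_trans re resy.
have r_gt0 : 0 < r.
  by rewrite lt_neqAle r_ge0 andbT; apply/eqP => rE; move: h1; rewrite -rE !mulr0 ltxx.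
have h2 : (1 - gamma) * (1 - w) * (1 - P) < (1 - beta) * (1 - c).
  have : (1 - c) * beta < (1 - c) * P + w * (1 - P) by rewrite -(ltr_pM2r r_gt0) -mulrA.
  by rewrite cE; lra.
(* This is where j >= 1 is used, through P <= c. *)
have h3 : 1 - c * P <= 2 * (1 - P) by nra.
have h4 : beta ^+ 2 * s * (1 - c) < 2 * (1 - P).
  rewrite -(ltr_pM2r e0).
  have : beta * (beta * e * s * (1 - c)) < beta * ((1 - c * P) * r) by rewrite ltr_pM2l.
  have P1 : 0 <= 1 - c * P by nra.
  have := ler_wpM2l P1 re; have := ler_wpM2r (ltW e0) h3; rewrite expr2; lra.
have gw : 0 < (1 - gamma) * (1 - w) by rewrite mulr_gt0 // subr_gt0.
have h5 : beta ^+ 2 * s * ((1 - gamma) * (1 - w)) < 2 * (1 - beta).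
  rewrite -(ltr_pM2r c1').
  have : (1 - gamma) * (1 - w) * (beta ^+ 2 * s * (1 - c))
    < (1 - gamma) * (1 - w) * (2 * (1 - P)) by rewrite ltr_pM2l.
  by move: h2; lra.
have bs : 0 < beta ^+ 2 * s * (1 - gamma) by rewrite !mulr_gt0 ?exprn_gt0.
nra.
Qed.

(** The budget of the runs that end in a radius update. *)
Definition phi (s : R) : R := potential beta exit_bound exit_cost loop_cost s.

(** The bound on the number of queries. *)
Definition budget : R := 30 * (g / l + L / g * (1 + H / l)).

(** The counters [a] and [b] number the completed loops whose last run has at
    least one step and, respectively, a rate above or at most [gamma]. In the
    first case [k * l < g]; in the second one the residual has been multiplied
    by at most [2 * gamma]. *)
Definition contractive_inv (s : state E) : Prop :=
  let: State ph k D y0 yp y j q := s in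
  match ph with
  | OuterTest => q%:R <= budget /\ exists a b : nat,
      [/\ (a + b <= k)%N, a%:R * l <= g, res y <= r0 * (2 * gamma) ^+ b &
        q%:R <= 1 + phi (invrate k D) + k%:R * (L / g) + (a + b)%:R]
  | InnerTest => exists a b : nat,
      [/\ (a + b <= k.-1)%N /\ a%:R * l <= g,
        res y0 <= r0 * (2 * gamma) ^+ b, eps < r0 * (2 * gamma) ^+ b,
        j%:R <= loop_cost &
        q%:R <= 1 + phi (invrate k D) + k.-1%:R * (L / g) + (a + b)%:R + j%:R]
  | _ => q%:R <= budget
  end.

Lemma exit_bound_ge0 : 0 <= exit_bound.
Proof.
by rewrite divr_ge0 ?mulr_ge0 ?subr_ge0 ?exprn_ge0 ?(ltW beta_lt1)
   ?(ltW gamma_lt1) ?(ltW beta_gt0).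
Qed.

Lemma exit_cost_ge0 : 0 <= exit_cost.
Proof.
have g0 := neg_ln_gamma_gt0; have L1 := log_ge1.
by rewrite addr_ge0 // divr_ge0 ?mulr_ge0 ?addr_ge0 // ?(ltW g0) // (le_trans ler01).
Qed.

Lemma log_ratio_ge0 : 0 <= L / g.
Proof. by rewrite divr_ge0 ?(ltW neg_ln_gamma_gt0) // (le_trans ler01 log_ge1). Qed.

Lemma loop_cost_ge0 : 0 <= loop_cost.
Proof. by rewrite addr_ge0 // log_ratio_ge0. Qed.

(** Uses [1 - gamma >= g / (1 + g)], which is [exp g >= 1 + g]. *)
Lemma exit_cost_scaled : exit_cost / (1 - gamma) <= 2 + 4 * (L / g).
Proof.
have g0 := neg_ln_gamma_gt0; have L1 := log_ge1.
have g1 : 0 < 1 - gamma by rewrite subr_gt0.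
have gE : gamma * (1 + g) <= 1.
  have := expR_ge1Dx g; rewrite expRN lnK ?posrE // => h.
  by have := ler_wpM2l gamma_ge0 h; rewrite divff // gt_eqF.
have xg : L / g * g = L by rewrite divfK // gt_eqF.
rewrite ler_pdivrMr // /exit_cost.
have yg : 2 * L / (1 + g) * (1 + g) = 2 * L by rewrite divfK // gt_eqF // addr_gt0.
have h1g : 0 < 1 + g by rewrite addr_gt0.
rewrite -(ler_pM2r h1g) mulrDl yg -mulrA.
have x_ge0 := log_ratio_ge0.
have h2 : g <= (1 - gamma) * (1 + g) by lra.
have h3 : 0 <= 2 + 4 * (L / g) by lra.
apply: le_trans (ler_wpM2l h3 h2).
by move: xg; lra.
Qed.

Lemma phi_le s : phi s <= 11 + 19 * (L / g).
Proof.
apply: (@le_trans _ _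
  (exit_cost * beta ^+ 2 * exit_bound / (1 - beta) + 3 * loop_cost)).
  by apply: potential_le => //; [exact: exit_cost_ge0|exact: loop_cost_ge0].
have := exit_cost_scaled; rewrite /loop_cost.
have -> : exit_cost * beta ^+ 2 * exit_bound / (1 - beta) = 4 * (exit_cost / (1 - gamma)).
  rewrite /exit_bound; field.
  by rewrite !subr_eq0 gt_eqF // [1 == _]gt_eqF // gt_eqF.
lra.
Qed.

Lemma log_beta_le : l <= L.
Proof.
rewrite /query_log lerN2 ler_ln ?posrE ?beta_mul_gt0 //.
by rewrite ger_pMr // gerBl ltW.
Qed.

(** Absolute constants are absorbed by the budget, as [L >= l]. *)
Lemma ratio_sum_ge2 : 2 <= g / l + L / g.
Proof.
have g0 := neg_ln_gamma_gt0; have l0 := neg_ln_beta_gt0.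
apply: (@le_trans _ _ (g / l + l / g)); last first.
  by rewrite lerD2l ler_wpM2r ?invr_ge0 ?(ltW g0) // log_beta_le.
move: (g) (l) g0 l0 => a b a0 b0.
have -> : a / b + b / a = 2 + (a - b) ^+ 2 / (a * b).
  by field; rewrite !gt_eqF.
by rewrite lerDl divr_ge0 ?sqr_ge0 // mulr_ge0 // ltW.
Qed.

Lemma one_le_budget : 1 <= budget.
Proof.
have := ratio_sum_ge2; have x_ge0 := log_ratio_ge0; rewrite /budget.
have h0 : 0 <= H / l by rewrite divr_ge0 ?(ltW ln_ratio_gt0) ?(ltW neg_ln_beta_gt0).
have := mulr_ge0 x_ge0 h0; lra.
Qed.

Lemma inner_budget (k a b j q : nat) (s : R) : eps < tolk k.-1 ->
  (a + b <= k.-1)%N -> a%:R * l <= g -> eps < r0 * (2 * gamma) ^+ b ->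
  j%:R <= loop_cost ->
  q%:R <= 1 + phi s + k.-1%:R * (L / g) + (a + b)%:R + j%:R ->
  q%:R <= budget.
Proof.
move=> /loops_le kH abk al bH jc qs.
have g0 := neg_ln_gamma_gt0; have l0 := neg_ln_beta_gt0; have x_ge0 := log_ratio_ge0.
have two := ratio_sum_ge2; have ph := phi_le s.
have h0 : 0 <= H / l by rewrite divr_ge0 ?(ltW ln_ratio_gt0) ?(ltW neg_ln_beta_gt0).
have kh : k.-1%:R <= H / l by rewrite ler_pdivlMr.
have kx := ler_wpM2r x_ge0 kh.
have {}al : a%:R <= g / l by rewrite ler_pdivlMr.
have gl0 : 0 <= g / l by rewrite divr_ge0 ?(ltW g0) ?(ltW l0).
suff ab : (a + b)%:R <= g / l + 2 * (H / l * (L / g)) + L / g.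
  have hx := mulr_ge0 h0 x_ge0.
  move: jc qs ph two kx ab hx x_ge0 gl0; rewrite /loop_cost /budget.
  move: (g / l) (L / g) (H / l) (k.-1%:R) ((a + b)%:R) (phi s) => y x h k' ab' p. lra.
(* If gamma >= 1/4 then L / g >= 1, and counting loops suffices; otherwise
   2 * gamma <= gamma ^ (1/2), which bounds b logarithmically. *)
have [gam|gam] := leP 4^-1 gamma.
  have gL : g <= L.
    rewrite /query_log lerN2 ler_ln ?posrE ?beta_mul_gt0 //.
    exact: le_trans beta_mul_le _.
  have x1 : 1 <= L / g by rewrite ler_pdivlMr // mul1r.
  have abh : (a + b)%:R <= H / l by apply: le_trans kh; rewrite ler_nat.
  have := ler_wpM2l h0 x1; have := mulr_ge0 h0 x_ge0; lra.
rewrite natrD; suff : b%:R <= 2 * (H / l * (L / g)) by lra.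
have {}bH : b%:R * - ln (2 * gamma) <= H.
  by apply: pow_log; rewrite ?mulr_gt0 // mulrC.
have ln2g : g <= 2 * - ln (2 * gamma).
  have : ln gamma <= ln (4^-1).
    by rewrite ler_ln ?posrE ?invr_gt0 // ltW.
  rewrite lnV ?posrE // (_ : 4 = 2 * 2 :> R); last by lra.
  rewrite !lnM ?posrE //; lra.
have bg : b%:R * g <= 2 * H.
  by have := ler_wpM2l (ler0n R b) ln2g; lra.
have -> : 2 * (H / l * (L / g)) = 2 * H * (L / l) / g.
  by move: (g) (l) g0 l0 => x y x_gt0 y_gt0; field; rewrite !gt_eqF.
rewrite ler_pdivlMr //; apply: le_trans bg _.
rewrite ler_peMr ?mulr_ge0 ?(ltW ln_ratio_gt0) // ler_pdivlMr // mul1r.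
exact: log_beta_le.
Qed.

Lemma contractive_inv_init : contractive_inv (adaghal_init T x0).
Proof.
split; first exact: one_le_budget.
exists 0%N, 0%N; split=> //; rewrite ?mul0r ?(ltW neg_ln_gamma_gt0) // ?mulr1 //.
rewrite !addr0 lerDl potential_ge0 // ?exit_bound_ge0 ?exit_cost_ge0 ?loop_cost_ge0 //.
exact: ltW (invrate_gt0 0 (lexx r0)).
Qed.

Lemma contractive_inv_step s : state_inv s -> contractive_inv s ->
  contractive_inv (step s).
Proof.
have x_ge0 := log_ratio_ge0.
case: s => -[] k D y0 yp y j q // [r0D].
- move=> [Cy resy epsk] [qB [a [b [abk al resb qs]]]]; rewrite /step /=.
  case: leP => // resy'; exists a, b; split=> //.
  + exact: lt_le_trans resb.
  + exact: loop_cost_ge0.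
  + rewrite addr0 /=; apply: le_trans qs _; rewrite !lerD2r lerD2l.
    apply: potential_mono; rewrite ?exit_cost_ge0 ?loop_cost_ge0 //.
    have s0 := invrate_gt0 k r0D.
    by rewrite invrate_loop ler_pdivlMr // ger_pMr // ltW.
- move=> inv [a [b [[abk al] resb epsb jc qs]]].
  have qB := inner_budget (inv_eps inv) abk al epsb jc qs.
  have kE : k%:R = k.-1%:R + 1 :> R by rewrite natr1 (prednK (inv_k inv)).
  case: inner_stepP => [resy|resy j0 saf|resy saf TD|a' resy saf DT ->] //.
  + split=> //; have [j0|j0] := posnP j.
      exists a, b; split=> //; first exact: leq_trans (leq_pred _).
        by rewrite (inv_start inv j0).
      by rewrite kE mulrDl; move: qs; rewrite j0; lra.
    have k1 : ((a + b).+1 <= k)%N by rewrite -(prednK (inv_k inv)).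
    have r_ge0 : 0 <= res y0 := res_ge0 y0.
    have dec := residual_decay_first r0D inv j0.
    have /andP[w0 w1] := weight_itv k r0D.
    have cE := contr_contractive k r0D.
    (* The loop is counted by b or by a. *)
    have [tg|tg] := leP (rate k D) gamma.
      exists a, b.+1; split=> //; first by rewrite addnS.
        rewrite exprS mulrCA.
        apply: (@le_trans _ _ (2 * gamma * res y0)).
          apply: le_trans dec _; rewrite ler_wpM2r // cE.
          have : weight k D <= rate k D.
            by rewrite weight_rate // ger_pMr ?rate_gt0 // gerBl ltW.
          have : 0 <= gamma * weight k D by rewrite mulr_ge0 // ltW.
          lra.
        by rewrite ler_wpM2l // mulr_ge0.
      move: qs jc; rewrite kE mulrDl addnS /loop_cost -natr1; lra.
    exists a.+1, b; split=> //.
    * have : gamma <= beta ^+ k.+1 by rewrite ltW // (lt_le_trans tg) // rate_le.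
      rewrite -ler_ln ?posrE ?exprn_gt0 // lnXn // -mulr_natl => h.
      have ak : a.+1%:R <= k.+1%:R :> R.
        by rewrite ler_nat ltnS (leq_trans (leq_addr b a)) // (leq_trans _ k1).
      have := ler_wpM2r (ltW neg_ln_beta_gt0) ak; lra.
    * apply: le_trans resb; apply: le_trans dec _.
      rewrite ler_piMl // cE; have : 0 <= (1 - gamma) * (1 - weight k D).
        by rewrite mulr_ge0 ?subr_ge0 ?ltW.
      lra.
    * move: qs jc; rewrite kE mulrDl addSn /loop_cost -natr1; lra.
  + have qr := query_rate r0D inv saf resy.
    exists a, b; split=> //; first exact: run_length_log r0D qr.
    rewrite -!natr1; lra.
  + have qr := query_rate r0D inv saf resy.
    have sS := exit_invrate r0D inv resy DT.
    exists a, b; split=> //.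
    * exact: le_trans (res_pick _ _) resb.
    * exact: loop_cost_ge0.
    * rewrite addr0 invrate_reset.
      apply: (@le_trans _ _ (1 + (phi (invrate k D) + j.+1%:R)
        + k.-1%:R * (L / g) + (a + b)%:R)).
        by rewrite -!natr1; lra.
      rewrite !lerD2r lerD2l; apply: potential_jump => //.
      - exact: exit_cost_ge0.
      - exact: loop_cost_ge0.
      - exact: invrate_gt0.
      - exact: run_length_exit r0D qr.
      - exact: run_length_log r0D qr.
Qed.

Lemma contractive_outputs : exists s,
  [/\ adaghal_outputs T pick beta beta' eps x0 s, res (ag_y s) <= eps &
    (ag_queries s)%:R <= budget].
Proof.
have [|s [out inv cinv]] :=
  run_outputs contractive_inv_init contractive_inv_step (Q := budget).
  move=> s run inv; case: s run inv => -[] k D y0 yp y j q //= _ [r0D inv].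
    by case.
  move=> [a [b [[abk al] resb epsb jc qs]]].
  exact: inner_budget (inv_eps inv) abk al epsb jc qs.
exists s; split=> //; case: out inv cinv => _.
  case: s => -[] k D y0 yp y j q /= [] // _ [r0D].
    by case.
  case=> _ _ _ _; rewrite leNgt => /negP[].
  have : 0 <= rate k D * (1 - beta').
    by rewrite mulr_ge0 ?subr_ge0 ?(ltW (rate_gt0 k r0D)) // ltW.
  by apply: lt_le_trans; rewrite subr_lt0.
by case: s => -[] k D y0 yp y j q /= [] // _ [].
Qed.

End Contractive.

End Run.

(** * The three regimes *)

(** If the initial residual is small enough, the first test ends the run. *)
Lemma outputs_start (R : realType) (E : normedModType R) (T : E -> E)
    (pick : E -> E -> E) (beta beta' eps : R) (x0 : E) :
  residual T x0 <= eps ->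
  adaghal_outputs T pick beta beta' eps x0
    (State Converged 0 (residual T x0) x0 x0 x0 0 1).
Proof. by move=> r0e; split; [exists 1%N; rewrite /= r0e|left]. Qed.

Lemma lipschitz_dist (R : realType) (E : normedModType R) (T : E -> E)
    (C : set E) (gamma : R) : gamma.-lipschitz_C T ->
  forall x y, C x -> C y -> `|T x - T y| <= gamma * `|x - y|.
Proof. by move=> lip x y Cx Cy; exact: (lip (x, y)). Qed.

Lemma convex_comb (R : realType) (E : normedModType R) (C : set E) :
  convex_set C -> forall (lam : R) u v, 0 <= lam -> lam <= 1 -> C u -> C v ->
  C (lam *: u + (1 - lam) *: v).
Proof.
move=> cvx lam u v l0 l1 Cu Cv.
have := cvx u v (Itv01 l0 l1); rewrite !inE; exact.
Qed.

Section Constants.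
Context (R : realType) (b : R) (b_lt1 : b < 1).

Lemma weaken_const (beta theta Delta e : R) : 0 < beta -> beta < 1 ->
  beta <= b -> 0 < theta -> 0 <= Delta -> 0 < e ->
  run_const beta theta / (1 - beta) * (Delta / (beta ^+ 3 * e))
    <= 3 / (1 - b) * (Delta / e * (query_log beta / (theta * beta ^+ 4))).
Proof.
move=> be0 be1 beb th0 De0 e0; have b1 : 0 < 1 - b by rewrite subr_gt0.
have be1' : 0 < 1 - beta by rewrite subr_gt0.
have L0 := le_trans ler01 (log_ge1 be0 be1).
pose Y := Delta / e * (query_log beta / (theta * beta ^+ 4)).
have Y0 : 0 <= Y by rewrite !(mulr_ge0, invr_ge0) // ?exprn_ge0 ?ltW.
rewrite -/Y [X in X <= _](_ : _ = 3 * (beta / (1 - beta)) * Y); last first.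
  by rewrite /Y /run_const; field; rewrite !gt_eqF.
rewrite ler_wpM2r // ler_wpM2l // ler_pdivrMr // mulrC ler_pdivlMr //.
nra.
Qed.

Lemma one_le_const (beta theta Delta e : R) : 0 < beta -> beta < 1 ->
  beta <= b -> 0 < theta -> theta <= 1 -> 0 < e -> e <= Delta ->
  1 <= 3 / (1 - b) * (Delta / e * (query_log beta / (theta * beta ^+ 4))).
Proof.
move=> be0 be1 beb th0 th1 e0 eD; have b1 : 0 < 1 - b by rewrite subr_gt0.
apply: mulr_ege1; first by rewrite ler_pdivlMr // mul1r; nra.
apply: mulr_ege1; first by rewrite ler_pdivlMr // mul1r.
rewrite ler_pdivlMr ?mulr_gt0 ?exprn_gt0 // mul1r.
apply: le_trans (log_ge1 be0 be1); apply: mulr_ile1 => //;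
  rewrite ?exprn_ge0 ?exprn_ile1 ?(ltW th0) ?(ltW be0) ?(ltW be1) //.
Qed.

End Constants.

Lemma contraction_regime (R : realType) (E : normedModType R) (T : E -> E)
    (pick : E -> E -> E) (gamma beta beta' eps : R) (x0 : E) :
  picks_smaller T pick ->
  0 < beta -> beta < 1 -> 0 < beta' -> beta' < 1 -> 0 < eps ->
  gamma.-lipschitz T -> 0 <= gamma -> gamma < 1 ->
  exists s : state E,
    [/\ adaghal_outputs T pick beta beta' eps x0 s,
        residual T (ag_y s) <= eps
      & 0 < gamma -> eps < residual T x0 ->
        (ag_queries s)%:R <=
          30 * (ln gamma^-1 / ln beta^-1
                + ln (beta * (1 - beta)) / ln gamma
                + ln (residual T x0 / eps) / ln gamma^-1
                  * (1 + ln (1 - beta) / ln beta))].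
Proof.
move=> pk be0 be1 be'0 be'1 e0 lip g0 g1.
have [r0e|r0e] := leP (residual T x0) eps.
  exists (State Converged 0 (residual T x0) x0 x0 x0 0 1).
  by split=> //; exact: outputs_start.
have {}lip := lipschitz_dist lip.
(* The bounds need a positive Lipschitz constant, and 1/2 serves for gamma = 0. *)
have [gz|gnz] := eqVneq gamma 0.
  have lip' x y : setT x -> setT y -> `|T x - T y| <= 2^-1 * `|x - y|.
    move=> *; apply: le_trans (lip x y I I) _.
    by rewrite gz mul0r mulr_ge0.
  have [|||s [out conv _]] := contractive_outputs pk be0 be1 be'0 be'1 e0 _ I
    (fun _ _ => I) (fun _ _ _ _ _ _ _ => I) lip' r0e; try lra.
  by exists s; split=> //; rewrite gz ltxx.
have gp : 0 < gamma by rewrite lt_neqAle eq_sym gnz.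
have [s [out conv qs]] := contractive_outputs pk be0 be1 be'0 be'1 e0 g0 I
  (fun _ _ => I) (fun _ _ _ _ _ _ _ => I) lip r0e gp g1.
exists s; split=> // _ _; apply: le_trans qs _; rewrite /budget /query_log.
have be1' : 0 < 1 - beta by rewrite subr_gt0.
rewrite !lnV ?posrE // lnM ?posrE //.
have lb : ln beta < 0 by rewrite ln_lt0 ?be0.
have lg : ln gamma < 0 by rewrite ln_lt0 ?gp.
rewrite le_eqVlt; apply/orP; left; apply/eqP; field.
by rewrite ?oppr_eq0 !lt_eqF.
Qed.

Lemma bounded_regime (R : realType) (b : R) (E : normedModType R) (T : E -> E)
    (pick : E -> E -> E) (gamma beta beta' eps theta : R) (x0 : E) (C : set E)
    (D : R) :
  b < 1 -> picks_smaller T pick ->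
  0 < beta -> beta < 1 -> 0 < beta' -> beta' < 1 -> 0 < eps ->
  (forall (lam : R) u v, 0 <= lam -> lam <= 1 -> C u -> C v ->
    C (lam *: u + (1 - lam) *: v)) ->
  (forall x, C x -> C (T x)) -> gamma.-lipschitz_C T ->
  0 <= gamma -> (forall x y, C x -> C y -> `|x - y| <= D) -> C x0 ->
  beta <= b -> 0 < theta -> theta <= 1 ->
  theta = beta' \/ theta = 1 /\ gamma <= 1 -> eps < residual T x0 ->
  exists s : state E,
    [/\ adaghal_outputs T pick beta beta' eps x0 s,
        state_inv T beta beta' eps gamma x0 C s, ag_D s <= D / beta &
        forall e, 0 < e -> e <= tol T beta x0 (ag_k s).-1 ->
          (ag_queries s)%:R <=
            3 / (1 - b) * (D / e * (query_log beta / (theta * beta ^+ 4)))].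
Proof.
move=> b1 pk be0 be1 be'0 be'1 e0 cvx CT lip g0 diam Cx0 beb th0 th1 thP r0e.
have D0 : 0 <= D by apply: le_trans (diam _ _ Cx0 Cx0).
have [s [out inv bnd]] := bounded_outputs pk be0 be1 be'0 be'1 e0 g0 Cx0 CT
  cvx (lipschitz_dist lip) r0e diam th0 th1 thP.
exists s; split=> //; first by case: s bnd {out inv} => ? ? ? ? ? ? ? ? [].
move=> e e_gt0 ek; apply: le_trans (weaken_const b1 be0 be1 beb th0 D0 e_gt0).
exact: bounded_queries inv bnd _ ek.
Qed.

Lemma nonexpansive_regime (R : realType) (b : R) (E : normedModType R)
    (T : E -> E) (pick : E -> E -> E) (beta beta' eps : R) (x0 xstar : E) :
  b < 1 -> picks_smaller T pick ->
  0 < beta -> beta < 1 -> 0 < beta' -> beta' < 1 -> 0 < eps ->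
  1.-lipschitz T -> T xstar = xstar -> beta <= b ->
  exists s : state E,
    [/\ adaghal_outputs T pick beta beta' eps x0 s,
        residual T (ag_y s) <= eps
      & eps < residual T x0 ->
        (ag_queries s)%:R <=
          6 / (1 - b) * (`|x0 - xstar| / eps
                * (- ln (beta * (1 - beta)) / beta ^+ 4))].
Proof.
move=> b1 pk be0 be1 be'0 be'1 e0 lip fixT beb.
have [r0e|r0e] := leP (residual T x0) eps.
  exists (State Converged 0 (residual T x0) x0 x0 x0 0 1).
  by split=> //; exact: outputs_start.
(* The closed ball through x0 around the fixed point has diameter at most
   2 * `|x0 - xstar|. *)
pose C : set E := [set x | `|x - xstar| <= `|x0 - xstar|].
have cvx (lam : R) u v : 0 <= lam -> lam <= 1 -> C u -> C v ->
    C (lam *: u + (1 - lam) *: v).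
  rewrite /C /= => l0 l1 Cu Cv.
  have -> : lam *: u + (1 - lam) *: v - xstar
      = lam *: (u - xstar) + (1 - lam) *: (v - xstar).
    rewrite !scalerBr addrACA -opprD -scalerDl.
    by rewrite [lam + _]addrC subrK scale1r.
  apply: le_trans (ler_normD _ _) _; rewrite !normrZ !ger0_norm ?subr_ge0 //.
  have l1' : 0 <= 1 - lam by rewrite subr_ge0.
  have := ler_wpM2l l0 Cu; have := ler_wpM2l l1' Cv; lra.
have CT x : C x -> C (T x).
  move=> Cx; rewrite /C /= -{1}fixT; apply: le_trans Cx.
  by have := @lipschitz_dist _ _ _ _ _ lip x xstar I I; rewrite mul1r.
have lipC : 1.-lipschitz_C T by move=> [x y] _; exact: lip.
have diam x y : C x -> C y -> `|x - y| <= 2 * `|x0 - xstar|.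
  rewrite /C /= => Cx Cy; apply: le_trans (ler_distD xstar x y) _.
  by rewrite [`|xstar - y|]distrC; lra.
have [s [out inv _ qs]] := bounded_regime b1 pk be0 be1 be'0 be'1 e0 cvx CT
  lipC ler01 diam (lexx _) beb ltr01 (lexx 1) (or_intror (conj erefl (lexx 1))) r0e.
have [conv ek] : residual T (ag_y s) <= eps /\ eps <= tol T beta x0 (ag_k s).-1.
  case: out inv {qs} => _; case: s => -[] k D y0 yp y j q /= [] // _ [r0D].
    by case=> _ _ -> /ltW.
  (* A safeguard halt would give a positive number at most gamma - 1 = 0. *)
  case=> _ _ _ _; rewrite subrr leNgt => /negP[].
  by rewrite mulr_gt0 ?subr_gt0 // (rate_gt0 be0 e0 r0e).
exists s; split=> // _; apply: le_trans (qs eps e0 ek) _.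
rewrite le_eqVlt; apply/orP; left; apply/eqP; rewrite mul1r /query_log; field.
by rewrite subr_eq0 !gt_eqF.
Qed.

Lemma expansive_regime (R : realType) (b : R) (E : normedModType R)
    (T : E -> E) (pick : E -> E -> E) (gamma beta beta' eps : R) (x0 : E)
    (C : set E) (D : R) :
  b < 1 -> picks_smaller T pick ->
  0 < beta -> beta < 1 -> 0 < beta' -> beta' < 1 -> 0 < eps ->
  convex_set C -> (forall x, C x -> C (T x)) ->
  gamma.-lipschitz_C T -> 1 < gamma ->
  (forall x y, C x -> C y -> `|x - y| <= D) -> C x0 -> beta <= b ->
  exists s : state E,
    let eps_pred := tol T beta x0 (ag_k s).-1 in
    let eps_bar := Num.min (eps_pred / beta) D in
    let eps_hat := residual T (ag_y s) in
    [/\ adaghal_outputs T pick beta beta' eps x0 s,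
        eps_hat <= eps_bar,
        (ag_phase s = Converged -> eps_hat <= eps) /\
        (ag_phase s = Safeguarded ->
          eps_pred < (1 + beta ^+ 2) * (ag_D s / beta ^+ 2)
                     * ((gamma - 1) / (1 - beta'))),
        (1 + beta ^+ 2) * (ag_D s / beta ^+ 2)
          * ((gamma - 1) / (1 - beta'))
        <= D * (1 + beta ^+ 2) / beta ^+ 3 * ((gamma - 1) / (1 - beta'))
      & beta * eps < eps_hat -> eps_hat <= eps_bar ->
        (ag_queries s)%:R <=
          3 / (1 - b) * (D / eps_hat
                * (- ln (beta * (1 - beta)) / (beta' * beta ^+ 4)))].
Proof.
move=> b1 pk be0 be1 be'0 be'1 e0 cvx CT lip g1 diam Cx0 beb.
have ratio0 : 0 < (gamma - 1) / (1 - beta') by rewrite divr_gt0 ?subr_gt0.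
have r0_le : residual T x0 <= D by apply: diam => //; exact: CT.
have D0 : 0 <= D by exact: le_trans (normr_ge0 _) r0_le.
have div_le x : 0 <= x -> x <= x / beta.
  by move=> x0'; rewrite ler_pdivlMr // ler_piMr // ltW.
have radius_le d : d <= D / beta -> (1 + beta ^+ 2) * (d / beta ^+ 2)
    * ((gamma - 1) / (1 - beta'))
    <= D * (1 + beta ^+ 2) / beta ^+ 3 * ((gamma - 1) / (1 - beta')).
  move=> dD; rewrite ler_wpM2r ?(ltW ratio0) //.
  rewrite [D * _]mulrC -mulrA ler_wpM2l ?addr_ge0 ?exprn_ge0 ?(ltW be0) //.
  rewrite ler_pdivrMr ?exprn_gt0 // (_ : D / _ * _ = D / beta) //.
  by field; rewrite gt_eqF.
have [r0e|r0e] := leP (residual T x0) eps.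
  exists (State Converged 0 (residual T x0) x0 x0 x0 0 1) => /=; split=> //.
  - exact: outputs_start.
  - by rewrite le_min div_le // normr_ge0.
  - by apply: radius_le; apply: le_trans r0_le _; exact: div_le.
  - move=> ehat _; apply: one_le_const => //; first exact: ltW.
    by apply: lt_trans ehat; rewrite mulr_gt0.
have g0 : 0 <= gamma by exact: le_trans ler01 (ltW g1).
have [s [out inv Ds qs]] := bounded_regime b1 pk be0 be1 be'0 be'1 e0
  (convex_comb cvx) CT lip g0 diam Cx0 beb be'0 (ltW be'1) (or_introl erefl) r0e.
have [Cy [res_pred e_pred]] : C (ag_y s) /\ residual T (ag_y s)
    <= tol T beta x0 (ag_k s).-1 /\ eps < tol T beta x0 (ag_k s).-1.
  have tp := tol_le_pred be0 be1 e0 r0e.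
  case: out inv {qs Ds} => _; case: s => -[] k d y0 yp y j q /= [] // _ [r0D].
    by case=> Cy resy _ epsk; split=> //; split=> //; exact: le_trans (tp k).
  by case.
exists s => /=; split=> //.
- rewrite le_min (le_trans res_pred) ?div_le ?(ltW (lt_trans e0 e_pred)) //=.
  by apply: diam => //; exact: CT.
- case: out inv {qs Ds Cy res_pred e_pred} => _.
  case: s => -[] k d y0 yp y j q /= [] // _ [r0D]; first by case.
  case=> Cy _ epsk k0 rl; split=> // _.
  have d0 := radius_gt0 e0 r0e r0D; have be'1' : 0 < 1 - beta' by rewrite subr_gt0.
  move: rl; rewrite -ler_pdivlMr // /rate (tol_pred _ _ _ k0) => rl.
  set e := tol T beta x0 k.-1 in rl epsk *.
  have db0 : 0 < d / beta ^+ 2 by rewrite divr_gt0 ?exprn_gt0.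
  have {}rl : e <= d / beta ^+ 2 * ((gamma - 1) / (1 - beta')).
    have -> : e = d / beta ^+ 2 * (beta * (beta * e) / d).
      by field; rewrite !gt_eqF.
    by rewrite ler_wpM2l // ltW.
  apply: le_lt_trans rl _; rewrite -[X in _ < X]mulrA ltr_pMl ?(mulr_gt0 db0 ratio0) //.
  by rewrite ltrDl exprn_gt0.
- exact: radius_le.
- move=> ehat _; apply: qs => //; apply: lt_trans ehat; exact: mulr_gt0.
Qed.

Theorem theorem1 (R : realType) :
  (* 1: gamma < 1 *)
  (exists C1 : R, 0 < C1 /\
    forall (E : normedModType R) (T : E -> E) (pick : E -> E -> E)
      (gamma beta beta' eps : R) (x0 : E),
    picks_smaller T pick ->
    0 < beta -> beta < 1 -> 0 < beta' -> beta' < 1 -> 0 < eps ->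
    gamma.-lipschitz T -> 0 <= gamma -> gamma < 1 ->
    exists s : state E,
      [/\ adaghal_outputs T pick beta beta' eps x0 s,
          residual T (ag_y s) <= eps
        & 0 < gamma -> eps < residual T x0 ->
          (ag_queries s)%:R <=
            C1 * (ln gamma^-1 / ln beta^-1
                  + ln (beta * (1 - beta)) / ln gamma
                  + ln (residual T x0 / eps) / ln gamma^-1
                    * (1 + ln (1 - beta) / ln beta))])
  /\
  (* 2: gamma = 1 *)
  (forall b : R, b < 1 -> exists C2 : R, 0 < C2 /\
    forall (E : normedModType R) (T : E -> E) (pick : E -> E -> E)
      (beta beta' eps : R) (x0 xstar : E),
    picks_smaller T pick ->
    0 < beta -> beta < 1 -> 0 < beta' -> beta' < 1 -> 0 < eps ->
    1.-lipschitz T -> T xstar = xstar -> beta <= b ->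
    exists s : state E,
      [/\ adaghal_outputs T pick beta beta' eps x0 s,
          residual T (ag_y s) <= eps
        & eps < residual T x0 ->
          (ag_queries s)%:R <=
            C2 * (`|x0 - xstar| / eps
                  * (- ln (beta * (1 - beta)) / beta ^+ 4))])
  /\
  (* 3: gamma > 1, on a bounded convex set *)
  (forall b : R, b < 1 -> exists C3 : R, 0 < C3 /\
    forall (E : normedModType R) (T : E -> E) (pick : E -> E -> E)
      (gamma beta beta' eps : R) (x0 : E) (C : set E) (D : R),
    picks_smaller T pick ->
    0 < beta -> beta < 1 -> 0 < beta' -> beta' < 1 -> 0 < eps ->
    convex_set C -> (forall x, C x -> C (T x)) ->
    gamma.-lipschitz_C T -> 1 < gamma ->
    (forall x y, C x -> C y -> `|x - y| <= D) -> C x0 -> beta <= b ->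
    exists s : state E,
      let eps_pred := tol T beta x0 (ag_k s).-1 in
      let eps_bar := Num.min (eps_pred / beta) D in
      let eps_hat := residual T (ag_y s) in
      [/\ adaghal_outputs T pick beta beta' eps x0 s,
          eps_hat <= eps_bar,
          (ag_phase s = Converged -> eps_hat <= eps) /\
          (ag_phase s = Safeguarded ->
            eps_pred < (1 + beta ^+ 2) * (ag_D s / beta ^+ 2)
                       * ((gamma - 1) / (1 - beta'))),
          (1 + beta ^+ 2) * (ag_D s / beta ^+ 2)
            * ((gamma - 1) / (1 - beta'))
          <= D * (1 + beta ^+ 2) / beta ^+ 3 * ((gamma - 1) / (1 - beta'))
        & beta * eps < eps_hat -> eps_hat <= eps_bar ->
          (ag_queries s)%:R <=
            C3 * (D / eps_hat
                  * (- ln (beta * (1 - beta)) / (beta' * beta ^+ 4)))]).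
Proof.
split; first by exists 30; split=> // E T pick gamma beta beta' eps x0;
  exact: contraction_regime.
split=> b b1.
  exists (6 / (1 - b)); split; first by rewrite divr_gt0 // subr_gt0.
  by move=> E T pick beta beta' eps x0 xstar; exact: nonexpansive_regime.
exists (3 / (1 - b)); split; first by rewrite divr_gt0 // subr_gt0.
by move=> E T pick gamma beta beta' eps x0 C D; exact: expansive_regime.
Qed.
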